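(* Each element $S\in\mathcal{S}_\infty$ determines a unique total order $\prec_S$ on the natural numbers induced by $\vartriangleleft$; that is, the relation on $\mathbb{N}$ defined by $x\prec_S y$ if and only if $\mathsf{ad}_S(x)\vartriangleleft \mathsf{ad}_S(y)$ is a strict total order on $\mathbb{N}$, uniquely determined by $S$.
   Context: $\mathbb{N}=\{0,1,2,\dots\}$. For $m\in\mathbb{N}$ let $[m]=\{0,\dots,m-1\}$; also $[+\infty]=\mathbb{N}$ and $[-\infty]=-\mathbb{N}=\{\dots,-2,-1,0\}$. Uniform sets. For $t\in\mathbb{N}$ and $\varepsilon\in\{+,-\}$, $\mathcal{U}_{2t}^{\varepsilon}$ is the set of families $(s(i_0,\dots,i_t))$ of natural numbers indexed by $[m_0]\times[m_1]\times\cdots\times[m_t]$, where $m_0\in\mathbb{N}$ is arbitrary (finite) and $m_1=\cdots=m_t=\varepsilon\infty$; $\mathcal{U}_{2t+1}^{\varepsilon}$ is the set of such families with $m_0=\cdots=m_t=\varepsilon\infty$. Set $\mathcal{U}_d=\mathcal{U}_d^+\cup\mathcal{U}_d^-$ and $\mathcal{U}=\bigcup_{d\ge0}\mathcal{U}_d$. Mixed sets. $\mathcal{U}_\infty$ is the set of nonempty finite or infinite sequences $S=(S_t)_{t\in[m]}$, $m\in\{1,2,\dots\}\cup\{+\infty\}$, with $S_t\in\mathcal{U}$. Write $S_t=\big(s(t)(I)\big)_{I\in\Pi_{t,k_t}}$ with $\Pi_{t,k_t}=[m_{t,1}]\times\cdots\times[m_{t,k_t}]$, where $k_t$ is the number of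 indices of $S_t$. Let $\langle S\rangle\subseteq\mathbb{N}$ be the set of all values $s(t)(I)$. $S$ is injective if $s(t)(I)\ne s(p)(J)$ whenever $(t,I)\neq(p,J)$. Let $\mathcal{S}_\infty=\{S\in\mathcal{U}_\infty:\langle S\rangle=\mathbb{N},\ S\text{ injective}\}$. Address. For $S\in\mathcal{S}_\infty$ and $x\in\mathbb{N}$ with $x=s(t)(i_{t,1},\dots,i_{t,k_t})$, put $\mathsf{ad}_S(x)=(t,i_{t,1},\dots,i_{t,k_t})\in\mathbb{Z}^{1+k_t}$. Lexicographic order on $\bigcup_{k\ge1}\mathbb{Z}^k$: $(x_0,\dots,x_p)\vartriangleleft(y_0,\dots,y_q)$ iff either there is $r\le\min\{p,q\}$ with $x_i=y_i$ for all $i<r$ and $x_r<y_r$, or $p<q$ and $x_i=y_i$ for all $i=0,\dots,p$. *)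

(* Defs.v *)
From HB Require Import structures.
From mathcomp Require Import all_boot all_order all_algebra.
From mathcomp Require Import boolp classical_sets constructive_ereal.

Set Implicit Arguments.
Unset Strict Implicit.
Unset Printing Implicit Defensive.

Import Order.TTheory GRing.Theory Num.Theory.
Local Open Scope classical_set_scope.
Local Open Scope ring_scope.

(* [m] = {0, ..., m - 1}, [+oo] = N and [-oo] = {..., -2, -1, 0}, all as
   subsets of Z. *)
Definition interval_of (m : \bar nat) : pred int := fun i =>
  match m with
  | EFin n => (0 <= i) && (i < n%:Z)
  | EPInf => 0 <= i
  | ENInf => i <= 0
  end.

Definition index_type (m : \bar nat) : Type := {i : int | interval_of m i}.

(* [m_0] x ... x [m_t] for ms = [:: m_0; ...; m_t]; note that all2 also
   requires the two sequences to have the same length. *)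
Definition multi_index (ms : seq (\bar nat)) : Type :=
  {I : seq int | all2 interval_of ms I}.

Record family := Family {
  dims : seq (\bar nat);
  entry :> multi_index dims -> nat
}.

Variant sign := Plus | Minus.

Definition signed_infty (e : sign) : \bar nat :=
  match e with Plus => EPInf _ | Minus => ENInf _ end.

Definition uniform_signed (e : sign) (d : nat) : set family := [set F |
  if odd d then dims F = nseq d./2.+1 (signed_infty e)
  else exists m0 : nat, dims F = EFin m0 :: nseq d./2 (signed_infty e)].

Definition uniform_dim (d : nat) : set family :=
  uniform_signed Plus d `|` uniform_signed Minus d.

Definition uniform : set family := \bigcup_d uniform_dim d.

Record family_seq := FamilySeq {
  len : \bar nat;
  term :> index_type len -> family
}.

Definition mixed : set family_seq := [set S |
  ((exists n : nat, (0 < n)%N /\ len S = EFin n) \/ len S = EPInf _) /\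
  forall t, uniform (S t)].

(* The pairs (t, I) with t in [m] and I in Pi_{t, k_t}. *)
Definition position (S : family_seq) : Type :=
  {t : index_type (len S) & multi_index (dims (S t))}.

Definition value (S : family_seq) (u : position S) : nat :=
  S (tag u) (tagged u).

Definition values (S : family_seq) : set nat := range (@value S).

Definition S_infty : set family_seq := [set S |
  [/\ mixed S, values S = [set: nat] & injective (@value S)]].

Definition position_vector (S : family_seq) (u : position S) : seq int :=
  val (tag u) :: val (tagged u).

(* The default [::] is returned only if x is not a value of S; for S in
   S_infty, ad is determined by ad_value below. *)
Definition ad (S : family_seq) (x : nat) : seq int :=
  xget [::] [set a | exists u : position S, value u = x /\ a = position_vector u].

Lemma ad_value (S : family_seq) (hS : S_infty S) (u : position S) :
  ad S (value u) = position_vector u.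
Proof.
case: hS => _ _ injS; rewrite /ad; case: xgetP => [a _ [v [/injS -> ->]] //|].
by move=> /(_ (position_vector u)) []; exists u.
Qed.

(* For x = (x_0, ..., x_p) and y = (y_0, ..., y_q), r <= min{p, q} reads
   r < minn (size x) (size y), and p < q reads size x < size y. *)
Definition lex_lt (x y : seq int) : Prop :=
  (exists r : nat, [/\ (r < minn (size x) (size y))%N,
     forall i, (i < r)%N -> x`_i = y`_i & x`_r < y`_r]) \/
  ((size x < size y)%N /\ forall i, (i < size x)%N -> x`_i = y`_i).

Definition strict_total_order (T : Type) (R : T -> T -> Prop) : Prop :=
  [/\ forall x, ~ R x x,
      forall x y z, R x y -> R y z -> R x z
    & forall x y, x <> y -> R x y \/ R y x].

(* Main.v *)
Require Import Defs.
From mathcomp Require Import all_boot all_order all_algebra.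
From mathcomp Require Import boolp classical_sets constructive_ereal.

(** The relation [lex_lt] is the lexicographic order on all finite sequences of
    integers, with a proper prefix below its extensions, and this order is
    total ([lex_ltP]). Pulling a strict total order back along an injective map
    gives a strict total order, so everything rests on the injectivity of the
    address map ([ad_inj]). An address determines the position it describes
    ([position_vector_inj]): its head is the index of a term, and its tail is a
    multi-index into that term. As the values of [S] exhaust the natural
    numbers, every natural number sits at some position, and is recovered from
    its address by reading the value there. Finally, a relation prescribed
    pointwise is unique by extensionality. *)

Import Order.TTheory GRing.Theory Num.Theory.
Local Open Scope ring_scope.

(** Comparing first entries: the witness [r] of a strict inequality between
    [a :: x] and [b :: y] is either [0] or the successor of one between the
    tails. *)
Lemma lex_lt_cons (a b : int) (x y : seq int) :
  lex_lt (a :: x) (b :: y) <-> a < b \/ a = b /\ lex_lt x y.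
Proof.
split.
- case=> [[[|r] [ltr eqr lt_r]] | [lts eqs]]; first by left.
  + right; split; first exact: (eqr 0%N).
    left; exists r; split=> [|i lti|//]; first by move: ltr; rewrite /= minnSS.
    exact: (eqr i.+1).
  + right; split; first exact: (eqs 0%N).
    by right; split=> [//|i lti]; exact: (eqs i.+1).
- case=> [ltab | [<- [[r [ltr eqr lt_r]] | [lts eqs]]]].
  + by left; exists 0%N; split=> //=; rewrite minnSS.
  + left; exists r.+1; split=> [|[|i] lti|] //=; first by rewrite minnSS.
    exact: eqr.
  + by right; split=> // -[|i] lti //=; exact: eqs.
Qed.

(** Irreflexivity, transitivity and totality of [lex_lt] are all read off from
    the order structure of [seqlexi int]; the induction only matches the
    indexed description of the order with the recursive one. *)
Lemma lex_ltP (x y : seq int) :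
  lex_lt x y <-> ((x : seqlexi int) < (y : seqlexi int))%O.
Proof.
elim: x y => [|a x IHx] [|b y].
- by rewrite ltxx; split=> // -[[r []]|[]].
- by rewrite ltxi0s; split=> // _; right.
- by rewrite ltxis0; split=> // -[[r []]|[]]; rewrite ?minn0.
- rewrite lex_lt_cons IHx ltxi_cons; split.
  + by case=> [ltab | [-> ->]]; rewrite ?lexx // (ltW ltab) leNgt ltab.
  + case/andP=> leab /implyP ltxy; have [ltab | leba] := ltP a b; first by left.
    by right; split; [apply/eqP; rewrite eq_le leab | exact: ltxy].
Qed.

(** The type of the tail of a position depends on its head, so the heads are
    identified before the tails can be compared. *)
Lemma position_vector_inj (S : family_seq) : injective (@position_vector S).
Proof.
case=> t I [u J]; rewrite /position_vector /= => -[/val_inj eq_tu].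
by case: u / eq_tu J => J /val_inj ->.
Qed.

Lemma ad_inj (S : family_seq) (hS : S_infty S) : injective (ad S).
Proof.
have [_ valS _] := hS.
have pos x : exists u : position S, value u = x.
  have [u _ <-] : values S x by rewrite valS.
  by exists u.
move=> x y; have [[u <-] [v <-]] := (pos x, pos y).
by rewrite !ad_value // => /position_vector_inj ->.
Qed.

Theorem theorem3p19 (S : family_seq) (hS : S_infty S) :
  exists! prec : nat -> nat -> Prop,
    strict_total_order prec /\
    (forall x y : nat, prec x y <-> lex_lt (ad S x) (ad S y)).
Proof.
exists (fun x y => lex_lt (ad S x) (ad S y)); split; last first.
  move=> prec [_ precE]; apply: funext => x; apply: funext => y.
  by apply: propext; rewrite precE.
split=> //; split=> [x | x y z | x y neq_xy]; rewrite !lex_ltP.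
- by rewrite ltxx.
- exact: lt_trans.
- by apply/orP; rewrite -neq_lt; apply/eqP => /(ad_inj S hS).
Qed.
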